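(* Let $\mathcal{M}\subset\mathbb{R}^n$ be a locally symmetric $C^2$ submanifold with characteristic permutation $\sigma_*$. Let $\sigma\in\Sigma^n$ and $\bar x\in\mathcal{M}\cap\Delta(\sigma)$, and let $v\in N_{\mathcal{M}}(\bar x)$. Then $v_i=v_j$ whenever $i,j\in\mathbb{N}_n\setminus\mathrm{supp}(\sigma_* )$ belong to the same cycle of $\sigma$; equivalently, writing $v^F\in\mathbb{R}^{\kappa_*}$ for the subvector of $v$ formed by the coordinates with indices in $\mathbb{N}_n\setminus\mathrm{supp}(\sigma_* )$, $v^F$ is constant on each set of the partition of these indices induced by the cycles of $\sigma$ contained in $\mathbb{N}_n\setminus\mathrm{supp}(\sigma_* )$.
   Context: $\Sigma^n$ is the group of permutations of $\mathbb{N}_n=\{1,\dots,n\}$, acting on $\mathbb{R}^n$ by $(\sigma x)_i=x_{\sigma^{-1}(i)}$; $\mathrm{supp}(\sigma)$ is the set of indices not fixed by $\sigma$. $P(\sigma)$ is the partition of $\mathbb{N}_n$ into orbits of $\sigma$; $P(x)$ is the partition in which $i,j$ are in the same set iff $x_i=x_j$; $\Delta(\sigma)=\{x:P(x)=P(\sigma)\}$. $\mathbb{R}^n_{\ge}=\{x:x_1\ge\cdots\ge x_n\}$; $B(x,\delta)$ open ball. A set $S$ is locally symmetric if $S\cap\mathbb{R}^n_{\ge}\neq\emptyset$ and for every $x\in S$ there is $\delta>0$ with $\sigma(S\cap B(x,\delta))=S\cap B(x,\delta)$ for all $y\in S\cap B(x,\delta)$ and all $\sigma$ with $\sigma y=y$.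 A locally symmetric $C^2$ submanifold is a connected $C^2$ submanifold without boundary which is locally symmetric. $N_{\mathcal{M}}(\bar x)$ is the normal space (orthogonal complement of the tangent space $T_{\mathcal{M}}(\bar x)$). A characteristic permutation is a $\sigma_*$ such that $\mathcal{M}\cap B(y,\delta)\subset\Delta(\sigma_* )$ for some $y\in\mathcal{M}$, $\delta>0$ (its partition is determined by $\mathcal{M}$); $\kappa_*=|\mathbb{N}_n\setminus\mathrm{supp}(\sigma_* )|$. *)

(* Defs.v *)
From HB Require Import structures.
From mathcomp Require Import all_boot all_order all_algebra all_fingroup.
From mathcomp Require Import all_classical all_reals all_analysis.
Set Implicit Arguments. Unset Strict Implicit. Unset Printing Implicit Defensive.
Import Order.TTheory GRing.Theory Num.Theory.
Import numFieldNormedType.Exports.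
Local Open Scope classical_set_scope.
Local Open Scope ring_scope.

Section Defs.
Context (R : realType) (n : nat).
Implicit Types (x y v w : 'rV[R]_n) (s : {perm 'I_n}) (M S U : set 'rV[R]_n).

Definition pact s x : 'rV[R]_n := \row_i x ord0 (s^-1 i)%g.

Definition psupp s : {set 'I_n} := [set i | s i != i].

Definition same_cycle s (i j : 'I_n) : Prop := j \in porbit s i.

Definition Delta s : set 'rV[R]_n :=
  [set x | forall i j : 'I_n, x ord0 i = x ord0 j <-> same_cycle s i j].

Definition ball_e x (d : R) : set 'rV[R]_n :=
  [set y | \sum_i (y ord0 i - x ord0 i) ^+ 2 < d ^+ 2].

Definition nonincr x : Prop :=
  forall i j : 'I_n, (i <= j)%N -> x ord0 j <= x ord0 i.

Definition locally_symmetric S : Prop :=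
  (exists x, S x /\ nonincr x) /\
  forall x, S x -> exists d : R, 0 < d /\
    forall y s, (S `&` ball_e x d) y -> pact s y = y ->
      pact s @` (S `&` ball_e x d) = S `&` ball_e x d.

Definition evec (i : 'I_n) : 'rV[R]_n := delta_mx 0 i.
Definition pderiv (i : 'I_n) (f : 'rV[R]_n -> R) : 'rV[R]_n -> R :=
  fun x => 'D_(evec i) f x.

Definition C2_on U (f : 'rV[R]_n -> R) : Prop :=
  forall (i j : 'I_n) x, U x ->
    [/\ derivable f x (evec i), derivable (pderiv i f) x (evec j),
        {for x, continuous f}, {for x, continuous (pderiv i f)}
      & {for x, continuous (pderiv j (pderiv i f))}].

Definition grad (f : 'rV[R]_n -> R) x : 'rV[R]_n := \row_i pderiv i f x.

Definition local_defining M x (m : nat) U (F : 'I_m -> 'rV[R]_n -> R) : Prop :=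
  [/\ open U, U x, (forall k, C2_on U (F k)),
      row_free (\matrix_(k < m) grad (F k) x)
    & M `&` U = [set y | U y /\ forall k, F k y = 0]].

Definition C2_submanifold M : Prop :=
  connected M /\
  exists d : nat, (d <= n)%N /\
    forall x, M x -> exists U (F : 'I_(n - d) -> 'rV[R]_n -> R),
      local_defining M x U F.

Definition mfd_tangent M x : set 'rV[R]_n :=
  [set w | exists (m : nat) U (F : 'I_m -> 'rV[R]_n -> R),
     local_defining M x U F /\
     (\matrix_(k < m) grad (F k) x) *m w^T = 0].

Definition mfd_normal M x : set 'rV[R]_n :=
  [set v | forall w, mfd_tangent M x w -> \sum_i v ord0 i * w ord0 i = 0].

Definition characteristic_perm M s : Prop :=
  exists y (d : R), [/\ M y, 0 < d & (M `&` ball_e y d) `<=` Delta s].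

End Defs.

(* Main.v *)
(** Let [tau] be the transposition of [i] and [j], and [e = e_i - e_j]. If [F] is a
chart of [M] at a point [x] with [x_i = x_j], then either [e] is tangent to [M]
at [x], or [M] lies in the hyperplane [y_i = y_j] near [x]: for [y] in [M] close
to [x], [tau y] is in [M] too and [y - tau y] is a multiple of [e], so strict
differentiability of [F] forces [y = tau y]. If [e] is tangent at [x], then [M]
leaves the hyperplane arbitrarily close to each of its points [z] near [x],
because [z + t e] is within [o(t)] of [M]. Hence the set of points near which
[M] lies in the hyperplane is clopen in [M]; it misses the points around which
[M] is in [Delta sstar], so it is empty. Thus [e] is tangent at [xbar], and [v]
is orthogonal to it. *)

Require Import Defs.
From HB Require Import structures.
From mathcomp Require Import all_boot all_order all_algebra all_fingroup.
From mathcomp Require Import all_classical all_reals all_analysis.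
From mathcomp Require Import ring lra.
Set Implicit Arguments. Unset Strict Implicit. Unset Printing Implicit Defensive.
Import Order.TTheory GRing.Theory Num.Theory.
Import numFieldNormedType.Exports.
Local Open Scope classical_set_scope.
Local Open Scope ring_scope.

(** * The sup norm on matrices, and radii of neighbourhoods *)

Lemma normmx_ge_entry (R : realType) (m n : nat) (A : 'M[R]_(m, n)) i j :
  `|A i j| <= `|A|.
Proof.
by rewrite [leRHS]/Num.norm /= mx_normrE; apply/bigmax_geP; right; exists (i, j).
Qed.

Lemma normmx_le (R : realType) (m n : nat) (A : 'M[R]_(m, n)) (c : R) :
  0 <= c -> (forall i j, `|A i j| <= c) -> `|A| <= c.
Proof.
move=> c0 Ac; rewrite [leLHS]/Num.norm /= mx_normrE.
by apply/bigmax_leP; split => // -[i j] _; exact: Ac.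
Qed.

Lemma normmx_tr (R : realType) (m n : nat) (A : 'M[R]_(m, n)) : `|A^T| = `|A|.
Proof.
apply/eqP; rewrite eq_le; apply/andP; split; apply: normmx_le => // i j.
  by rewrite mxE normmx_ge_entry.
by have := normmx_ge_entry A^T j i; rewrite mxE.
Qed.

Lemma normmx_mul_le (R : realType) (m n p : nat) (A : 'M[R]_(m, n))
    (B : 'M[R]_(n, p)) : `|A *m B| <= n%:R * `|A| * `|B|.
Proof.
apply: normmx_le => [|i j]; first by rewrite !mulr_ge0.
rewrite mxE; apply: le_trans (ler_norm_sum _ _ _) _.
have -> : n%:R * `|A| * `|B| = \sum_(k < n) `|A| * `|B|.
  by rewrite sumr_const card_ord -mulrA mulr_natl.
by apply: ler_sum => k _; rewrite normrM ler_pM ?normmx_ge_entry.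
Qed.

(** Passing to radii lets one [d] meet several smallness conditions at once, including those on
    pairs of points. *)
Lemma near_normP (R : realType) (V : normedModType R) (x : V) (P : V -> Prop) :
  (\forall y \near x, P y) <->
  \forall d \near (0 : R)^'+, forall y, `|y - x| < d -> P y.
Proof.
split=> [/nbhs_normP[r /= r0 xP]|dP].
  near=> d => y yd; apply: xP => /=; rewrite distrC.
  by apply: lt_trans yd _; near: d; exact: nbhs_right_lt.
near (0 : R)^'+ => d.
have d0 : 0 < d by near: d; exact: nbhs_right_gt.
apply/nbhs_normP; exists d => //= y /=; rewrite distrC.
by move: y; near: d.
Unshelve. all: by end_near. Qed.

Lemma near_right0_ex (R : realType) (P : R -> Prop) :
  (\forall d \near (0 : R)^'+, P d) -> exists2 d : R, 0 < d & P d.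
Proof.
move=> dP; near (0 : R)^'+ => d; exists d; near: d => //.
exact: nbhs_right_gt.
Unshelve. all: by end_near. Qed.

(** * Strict differentiability of C^2 functions *)

Lemma is_derive_partial (R : realType) (n : nat) (f : 'rV[R]_n -> R)
    (i : 'I_n) (y : 'rV[R]_n) (t : R) :
  derivable f (y + t *: evec R i) (evec R i) ->
  is_derive t 1 (fun s : R => f (y + s *: evec R i))
    (pderiv i f (y + t *: evec R i)).
Proof.
have E : (fun h : R => h^-1 *: (((fun s : R => f (y + s *: evec R i)) \o shift t)
      (h *: 1) - f (y + t *: evec R i))) =
    (fun h : R => h^-1 *: ((f \o shift (y + t *: evec R i)) (h *: evec R i)
      - f (y + t *: evec R i))).
  apply/funext => h /=; congr (_ *: (f _ - _)).
  by rewrite [h *: 1]mulr1 scalerDl addrCA.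
move=> df; apply: DeriveDef; first by rewrite /derivable E.
by rewrite /derive E.
Qed.

(** Mean value theorem along the [i]-th axis; the segment stays in the ball by convexity. *)
Lemma partial_increment_le (R : realType) (n : nat) (f : 'rV[R]_n -> R)
    (i : 'I_n) (x : 'rV[R]_n) (c d e : R) :
  (forall y, `|y - x| < d -> derivable f y (evec R i)) ->
  (forall y, `|y - x| < d -> `|pderiv i f y - c| <= e) ->
  forall y a, `|y - x| < d -> `|y + a *: evec R i - x| < d ->
    `|f (y + a *: evec R i) - f y - a * c| <= e * `|a|.
Proof.
move=> df dc y a.
wlog a0 : y a / 0 <= a => [hw yd yad|].
  have [/hw|a0] := leP 0 a; first exact.
  have := hw (y + a *: evec R i) (- a).
  rewrite scaleNr addrK oppr_ge0 (normrN a) => /(_ (ltW a0) yad yd).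
  by move=> h; apply: le_trans h; rewrite mulNr opprK -[in leLHS]normrN opprD opprB opprK.
move=> yd yad.
have seg t : t \in `[0, a]%R -> `|y + t *: evec R i - x| < d.
  rewrite in_itv/= => /andP[t0 ta].
  have [a00|a_neq0] := eqVneq a 0.
    have -> : t = 0 by apply/eqP; rewrite eq_le t0 -{1}a00 ta.
    by rewrite scale0r addr0.
  have {a_neq0}a0 : 0 < a by rewrite lt_neqAle eq_sym a_neq0.
  (* The convex combination is multiplied by [a] to avoid dividing. *)
  have E : a *: (y + t *: evec R i - x) =
      (a - t) *: (y - x) + t *: (y + a *: evec R i - x).
    by apply/rowP => k; rewrite !mxE; ring.
  rewrite -(ltr_pM2l a0) -[X in X * `|_|](gtr0_norm a0) -normrZ E.
  apply: le_lt_trans (ler_normD _ _) _; rewrite !normrZ (ger0_norm t0).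
  rewrite ger0_norm ?subr_ge0//.
  have [->|t_neq0] := eqVneq t 0; first by rewrite mul0r addr0 subr0 ltr_pM2l.
  have {t_neq0}t0 : 0 < t by rewrite lt_neqAle eq_sym t_neq0.
  rewrite [ltRHS](_ : _ = (a - t) * d + t * d); last by ring.
  apply: ler_ltD; last by rewrite ltr_pM2l.
  by rewrite ler_wpM2l ?subr_ge0// ltW.
have dg t : t \in `[0, a]%R -> is_derive t 1 (fun s : R => f (y + s *: evec R i))
    (pderiv i f (y + t *: evec R i)).
  by move=> /seg /df; exact: is_derive_partial.
pose g (t : R) := f (y + t *: evec R i).
have gdrv t : t \in `]0, a[%R -> is_derive t 1 g (pderiv i f (y + t *: evec R i)).
  by rewrite in_itv/= => /andP[t0 ta]; apply: dg; rewrite in_itv/= !ltW.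
have gcont : {within `[0, a], continuous g}.
  by apply: derivable_within_continuous => t /dg[].
have [t ta] := MVT_segment a0 gdrv gcont.
rewrite /g scale0r addr0 subr0 => ->.
rewrite [X in `|X|](_ : _ = (pderiv i f (y + t *: evec R i) - c) * a); last by ring.
by rewrite normrM ler_wpM2r// dc// seg.
Qed.

(** Go from [z] to [y] by changing one coordinate at a time and bound each increment by the mean
    value theorem, the partial derivatives being continuous at [x]. *)
Lemma C2_on_strict_diff (R : realType) (n : nat) (f : 'rV[R]_n -> R)
    (U : set 'rV[R]_n) (x : 'rV[R]_n) (e : R) :
  open U -> U x -> C2_on U f -> 0 < e ->
  \forall d \near (0 : R)^'+, forall y z, `|y - x| < d -> `|z - x| < d ->
    `|f y - f z - \sum_i pderiv i f x * (y - z) ord0 i| <= e * `|y - z|.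
Proof.
move=> oU Ux fC2 e0.
(* Each of the [n] increments costs [eta * |y - z|]; the successor keeps the denominator nonzero
   when [n = 0]. *)
pose eta := e / n.+1%:R.
have eta0 : 0 < eta by rewrite divr_gt0.
have nearU : \forall y \near x, U y by exact: open_nbhs_nbhs.
have : \forall y \near x, forall i : 'I_n,
    derivable f y (evec R i) /\ `|pderiv i f y - pderiv i f x| <= eta.
  apply: (@filter_forall _ _ _ (nbhs x) (nbhs_filter x)) => i.
  have [_ _ _ ci _] := fC2 i i x Ux; near=> y; split.
    by have [] := fC2 i i y; first near: y.
  near: y; have /cvgrPdist_le/(_ _ eta0) := ci.
  by apply: filterS => y; rewrite distrC.
move=> /near_normP; apply: filterS => d dP y z yd zd.
pose p (k : nat) : 'rV[R]_n := \row_i (if (i < k)%N then y ord0 i else z ord0 i).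
(* In the sup norm a ball is a box, so mixing coordinates of two of its points does not leave it. *)
have pd k : `|p k - x| < d.
  apply: (@le_lt_trans _ _ (Num.max `|y - x| `|z - x|)); last first.
    by rewrite gt_max yd zd.
  apply: normmx_le => [|i j]; first by rewrite le_max normr_ge0.
  rewrite !mxE le_max (ord1 i); case: ifP => _.
    by have := normmx_ge_entry (y - x) ord0 j; rewrite !mxE => ->.
  by have := normmx_ge_entry (z - x) ord0 j; rewrite !mxE => ->; rewrite orbT.
have pS (i : 'I_n) : p i.+1 = p i + (y - z) ord0 i *: evec R i.
  apply/rowP => j; rewrite !mxE eqxx/= ltnS leq_eqVlt.
  have [->|ij] := eqVneq j i; first by rewrite eqxx/= ltnn; ring.
  rewrite (_ : (j == i :> nat) = false) ?mulr0 ?addr0//.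
  by apply/negbTE; move: ij; apply: contra => /eqP/val_inj->.
have p0 : p 0%N = z by apply/rowP => j; rewrite mxE.
have pn : p n = y by apply/rowP => j; rewrite mxE ltn_ord.
have -> : f y - f z = \sum_(i < n) (f (p i.+1) - f (p i)).
  by rewrite -(big_mkord xpredT (fun i => f (p i.+1) - f (p i)))
    telescope_sumr// p0 pn.
rewrite -sumrB; apply: le_trans (ler_norm_sum _ _ _) _.
apply: (@le_trans _ _ (\sum_(i < n) eta * `|y - z|)); last first.
  rewrite sumr_const card_ord -mulr_natl mulrA ler_wpM2r// /eta mulrCA.
  by rewrite ger_pMr// ler_pdivrMr// mul1r ler_nat.
apply: ler_sum => i _; rewrite pS mulrC.
apply: (@le_trans _ _ (eta * `|(y - z) ord0 i|)); last first.
  by rewrite ler_wpM2l ?(ltW eta0)// normmx_ge_entry.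
apply: (@partial_increment_le _ _ _ _ x _ d) => //.
- by move=> w /dP /(_ i) [].
- by move=> w /dP /(_ i) [].
- by rewrite -pS.
Unshelve. all: by end_near. Qed.

(** * Charts as vector-valued maps *)

Definition grad_mx (R : realType) (n m : nat) (F : 'I_m -> 'rV[R]_n -> R)
  (x : 'rV[R]_n) : 'M[R]_(m, n) := \matrix_(k < m) grad (F k) x.

Definition values (R : realType) (n m : nat) (F : 'I_m -> 'rV[R]_n -> R)
  (y : 'rV[R]_n) : 'cV[R]_m := \col_k F k y.

Lemma values_strict_diff (R : realType) (n m : nat) (M U : set 'rV[R]_n)
    (x : 'rV[R]_n) (F : 'I_m -> 'rV[R]_n -> R) (e : R) :
  local_defining M x U F -> 0 < e ->
  \forall d \near (0 : R)^'+, forall y z, `|y - x| < d -> `|z - x| < d ->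
    `|values F y - values F z - grad_mx F x *m (y - z)^T| <= e * `|y - z|.
Proof.
move=> [oU Ux FC2 _ _] e0.
have : \forall d \near (0 : R)^'+, forall k y z, `|y - x| < d -> `|z - x| < d ->
    `|F k y - F k z - \sum_i pderiv i (F k) x * (y - z) ord0 i| <= e * `|y - z|.
  by apply: filter_forall => k; exact: (C2_on_strict_diff oU Ux (FC2 k) e0).
apply: filterS => d dP y z yd zd.
apply: normmx_le => [|k j]; first by rewrite mulr_ge0// ltW.
rewrite !mxE; apply: le_trans (dP k _ _ yd zd).
rewrite (eq_bigr (fun i => pderiv i (F k) x * (y - z) ord0 i))// => i _.
by rewrite !mxE (ord1 j).
Qed.

Lemma values_continuous (R : realType) (n m : nat) (M U : set 'rV[R]_n)
    (x y : 'rV[R]_n) (F : 'I_m -> 'rV[R]_n -> R) :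
  local_defining M x U F -> U y -> {for y, continuous (values F)}.
Proof.
move=> [_ _ FC2 _ _] Uy.
(* [C2_on] yields continuity only through an index in ['I_n]; for [n = 0] the space is a single
   point. *)
case: n => [|n] in M U x y F FC2 Uy *.
  have -> : values F = cst (values F y).
    by apply/funext => z; congr values; apply/rowP => -[].
  exact: cst_continuous.
apply/(@cvgrPdist_le _ _ _ _ (nbhs_filter y)) => e e0.
have : \forall z \near y, forall k, `|F k y - F k z| <= e.
  apply: (@filter_forall _ _ _ (nbhs y) (nbhs_filter y)) => k.
  have [_ _ + _ _] := FC2 k ord0 ord0 y Uy.
  by move=> /cvgrPdist_le/(_ _ e0).
apply: filterS => z zP; apply: normmx_le => [|k j]; first exact: ltW.
by rewrite !mxE.
Qed.

(** * Distance to the zero set of a chart *)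

(** This plays the part of the implicit function theorem: a minimiser over a compact ball of
    [|F y| + e * |y - p|] must be a zero of [F], since otherwise a Newton step with a right inverse
    of the Jacobian would lower the value. *)
Lemma zero_set_near (R : realType) (n m : nat) (M U : set 'rV[R]_n)
    (x : 'rV[R]_n) (F : 'I_m -> 'rV[R]_n -> R) :
  local_defining M x U F -> M x ->
  exists2 K : R, 0 < K & \forall p \near x,
    exists2 y, M y & `|y - p| <= K * `|values F p|.
Proof.
move=> Fdef Mx; have [oU Ux FC2 Jfree MU] := Fdef.
have Fx0 : values F x = 0.
  apply/colP => k; rewrite !mxE.
  have : (M `&` U) x by [].
  by rewrite MU => -[_ /(_ k)].
pose B := pinvmx (grad_mx F x).
have JB : grad_mx F x *m B = 1%:M by exact: mulmxVp.
pose C : R := m%:R * `|B| + 1.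
have C0 : 0 < C by rewrite ltr_wpDl// mulr_ge0.
have BC u : `|B *m u| <= C * `|u| :> R.
  apply: le_trans (normmx_mul_le _ _) _.
  by rewrite ler_wpM2r// lerDl.
(* With [e * C = 1/4], a Newton step changes [|F y|] to at most a quarter of it and raises the
   penalty by at most another quarter. *)
pose K := 4 * C; pose e := K^-1.
have K0 : 0 < K by rewrite mulr_gt0.
have e0 : 0 < e by rewrite invr_gt0.
have eK : e * K = 1 by rewrite mulVf// gt_eqF.
have nearU : \forall y \near x, U y by exact: open_nbhs_nbhs.
have [d d0 [dF dU]] : exists2 d : R, 0 < d &
    (forall y z, `|y - x| < d -> `|z - x| < d ->
    `|values F y - values F z - grad_mx F x *m (y - z)^T| <= e * `|y - z|) /\
    (forall y, `|y - x| < d -> U y).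
  apply: near_right0_ex; apply: filterI; first exact: values_strict_diff Fdef e0.
  exact/near_normP.
exists K => //.
have nearx : \forall p \near x, `|p - x| <= d / 4.
  apply/nbhs_normP; exists (d / 4) => /=; first by lra.
  by move=> q /= qd; rewrite distrC ltW.
(* The minimiser is within [K * |F p|] of [p] and the Newton step has length at most [C * |F p|], so
   the new point stays within [d / 2] of [x]. *)
have nearF : \forall p \near x, (K + C) * `|values F p| <= d / 4.
  have /(@cvgrPdist_le _ _ _ _ (nbhs_filter x)) := values_continuous Fdef Ux.
  have KC0 : 0 < K + C by rewrite addr_gt0.
  move=> /(_ (d / 4 / (K + C))) []; first by rewrite !divr_gt0.
  move=> r r0 rP; exists r => // q /rP /=; rewrite Fx0 sub0r normrN.
  by rewrite ler_pdivlMr// mulrC.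
have d2 : d / 2 < d by lra.
near=> p.
have px : `|p - x| <= d / 4 by near: p.
have Fp : (K + C) * `|values F p| <= d / 4 by near: p.
pose A := [set y : 'rV[R]_n | `|y - x| <= d / 2].
have dist_cont q : continuous (fun y : 'rV[R]_n => `|y - q|).
  move=> y; have Ny : Filter (nbhs y) := nbhs_filter y.
  by apply: cvg_norm; apply: cvgB; [exact: cvg_id|exact: cvg_cst].
pose phi (y : 'rV[R]_n) : R := `|values F y| + e * `|y - p|.
have pA : p \in A by rewrite inE; apply: le_trans px _; lra.
have cA : compact A.
  apply: bounded_closed_compact.
    exists (`|x| + d / 2); split; first exact: num_real.
    move=> r rP y /= yA; rewrite -[y](subrK x).
    apply: le_trans (ler_normD _ _) _; apply: le_trans (ltW rP).
    by rewrite addrC lerD2l.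
  rewrite (_ : A = (fun y => `|y - x|) @^-1` [set r | r <= d / 2])//.
  by apply: closed_comp; [move=> y _; exact: dist_cont|exact: closed_le].
have cphi : {within A, continuous phi}.
  apply: continuous_in_subspaceT => y; rewrite inE /A/= => yA.
  have Uy : U y by apply: dU; apply: le_lt_trans d2.
  have Ny : Filter (nbhs y) := nbhs_filter y.
  apply: cvgD; first exact: (cvg_norm (values_continuous Fdef Uy)).
  by apply: cvgMr; exact: dist_cont.
have [|y yA ymin] := compact_EVT_min _ cA cphi.
  by exists p; rewrite -inE.
have {yA}yx : `|y - x| <= d / 2 by move: yA; rewrite inE.
have phip : phi p = `|values F p| by rewrite /phi subrr normr0 mulr0 addr0.
(* Comparison with [p] itself, where the penalty vanishes, gives the distance bound. *)
have := ymin p pA; rewrite phip => yp.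
have Fyp : `|values F y| <= `|values F p|.
  by apply: le_trans yp; rewrite lerDl mulr_ge0// ltW.
have ypK : `|y - p| <= K * `|values F p|.
  rewrite -(ler_pM2l e0) mulrA eK mul1r.
  by apply: le_trans yp; rewrite lerDr.
exists y => //.
(* The Newton step [y'] strictly decreases [phi] unless [values F y = 0]. *)
pose y' := y - (B *m values F y)^T.
have yy' : y' - y = - (B *m values F y)^T by rewrite /y' addrC addKr.
have normyy' : `|y' - y| <= C * `|values F y| by rewrite yy' normrN normmx_tr.
have CF : C * `|values F y| <= C * `|values F p| by rewrite ler_pM2l.
have y'x : `|y' - x| <= d / 2.
  have -> : y' - x = (y' - y) + (y - p) + (p - x) by rewrite !addrA !subrK.
  do 2 (apply: le_trans (ler_normD _ _) _; rewrite -?lerBrDr).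
  lra.
have Fy' : `|values F y'| <= e * (C * `|values F y|).
  apply: le_trans (ler_wpM2l (ltW e0) normyy').
  have := dF y' y (le_lt_trans y'x d2) (le_lt_trans yx d2).
  by rewrite yy' linearN/= trmxK mulmxN mulmxA JB mul1mx opprK subrK.
have y'p : `|y' - p| <= C * `|values F y| + `|y - p|.
  have -> : y' - p = (y' - y) + (y - p) by rewrite addrA subrK.
  by apply: le_trans (ler_normD _ _) _; rewrite lerD2r.
have : phi y <= phi y' by apply: ymin; rewrite inE.
rewrite /phi => hphi.
have eC : e * C = 1 / 4 by rewrite /e /K; field; rewrite gt_eqF.
have {}y'p : e * `|y' - p| <= e * (C * `|values F y|) + e * `|y - p|.
  by rewrite -mulrDr ler_pM2l.
rewrite !mulrA eC in Fy' y'p.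
have Fy0 : `|values F y| = 0 by have := normr_ge0 (values F y); lra.
have : (M `&` U) y; last by case.
rewrite MU; split; first by apply: dU; apply: le_lt_trans d2.
by move=> k; have /colP/(_ k) := normr0_eq0 Fy0; rewrite !mxE.
Unshelve. all: by end_near. Qed.

(** * Transpositions and the direction normal to the hyperplane *)

Definition edir (R : realType) (n : nat) (i j : 'I_n) : 'rV[R]_n :=
  evec R i - evec R j.

Lemma norm_edir_le1 (R : realType) (n : nat) (i j : 'I_n) :
  i != j -> `|edir R i j| <= 1.
Proof.
move=> ij; apply: normmx_le => // k l; rewrite !mxE (ord1 k) eqxx/=.
have [->|_] := eqVneq l i; first by rewrite (negbTE ij) subr0 normr1.
by rewrite sub0r normrN; case: (l == j); rewrite ?normr0 ?normr1 ?ler01.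
Qed.

Lemma pact_tperm (R : realType) (n : nat) (i j : 'I_n) (y : 'rV[R]_n) :
  pact (tperm i j) y = y - (y ord0 i - y ord0 j) *: edir R i j.
Proof.
apply/rowP => k; rewrite !mxE tpermV eqxx/=.
have [->|ki] := eqVneq k i.
  rewrite tpermL; have [->|ij] := eqVneq i j; first by ring.
  by rewrite /=; ring.
have [->|kj] := eqVneq k j; first by rewrite tpermR /=; ring.
by rewrite tpermD 1?eq_sym//=; ring.
Qed.

(** Local symmetry uses Euclidean balls, the topology the sup norm; the comparison rests on
    [n * r^2 <= ((n+1) * r)^2]. *)
Lemma ball_e_near (R : realType) (n : nat) (x : 'rV[R]_n) (d : R) :
  0 < d -> \forall y \near x, ball_e x d y.
Proof.
move=> d0; apply/near_normP; near=> r => y yr.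
have r0 : 0 < r by near: r; exact: nbhs_right_gt.
have rd : n.+1%:R * r < d.
  by rewrite mulrC -ltr_pdivlMr//; near: r; apply: nbhs_right_lt; rewrite divr_gt0.
apply: (@le_lt_trans _ _ ((n.+1%:R * r) ^+ 2)); last first.
  by rewrite ltr_pXn2r// nnegrE ltW// mulr_gt0.
apply: (@le_trans _ _ (\sum_(i < n) r ^+ 2)).
  apply: ler_sum => i _; rewrite -[leLHS]ger0_norm ?sqr_ge0// normrX.
  rewrite lerXn2r ?nnegrE ?(ltW r0)//; apply: le_trans (ltW yr).
  by have := normmx_ge_entry (y - x) ord0 i; rewrite !mxE.
rewrite sumr_const card_ord -[leLHS]mulr_natl exprMn ler_wpM2r ?sqr_ge0//.
rewrite -natrX ler_nat; apply: (@leq_trans n.+1); first exact: leqnSn.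
by rewrite expnS leq_pmulr// expn_gt0.
Unshelve. all: by end_near. Qed.

Lemma locally_symmetric_coord_eq (R : realType) (n m : nat) (M U : set 'rV[R]_n)
    (x : 'rV[R]_n) (F : 'I_m -> 'rV[R]_n -> R) (i j : 'I_n) :
  locally_symmetric M -> local_defining M x U F -> M x ->
  i != j -> x ord0 i = x ord0 j -> grad_mx F x *m (edir R i j)^T != 0 ->
  \forall y \near x, M y -> y ord0 i = y ord0 j.
Proof.
move=> [_ Msym] Fdef Mx ij xij Je0; have [oU Ux _ _ MU] := Fdef.
pose s := tperm i j.
have sx : pact s x = x by rewrite pact_tperm xij subrr scale0r subr0.
have [r [r0 rM]] := Msym x Mx.
have nearr := ball_e_near x r0.
have xr : ball_e x r x by exact: nbhs_singleton nearr.
have nearU : \forall y \near x, U y by exact: open_nbhs_nbhs.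
pose c := `|grad_mx F x *m (edir R i j)^T|.
have c0 : 0 < c by rewrite normr_gt0.
apply/near_normP; near=> d => y yd My.
have dP : forall y z, `|y - x| < d -> `|z - x| < d ->
    `|values F y - values F z - grad_mx F x *m (y - z)^T| <= c / 2 * `|y - z|.
  by near: d; apply: values_strict_diff Fdef _; rewrite divr_gt0.
have rU : forall y, `|y - x| < d -> U y /\ ball_e x r y.
  by near: d; apply/near_normP; exact: filterI.
(* The swap fixes [x] and only permutes the entries of [y - x]. *)
have syd : `|pact s y - x| < d.
  apply: le_lt_trans yd; apply: normmx_le => // k l; rewrite (ord1 k).
  have -> : (pact s y - x) ord0 l = (y - x) ord0 (s^-1 l)%g.
    by rewrite -{1}sx !mxE.
  exact: normmx_ge_entry.
have [Uy ry] := rU _ yd; have [Usy _] := rU _ syd.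
have Msy : M (pact s y).
  have : (M `&` ball_e x r) (pact s y) by rewrite -(rM x s (conj Mx xr) sx); exists y.
  by case.
have F0 z : M z -> U z -> values F z = 0.
  move=> Mz Uz; apply/colP => k; rewrite !mxE.
  have : (M `&` U) z by [].
  by rewrite MU => -[_ /(_ k)].
(* Both values vanish, so with [t = y_i - y_j] the estimate reads [|t| * c <= c/2 * |t| * |e|],
   where [|e| <= 1]; hence [t = 0]. *)
have := dP _ _ yd syd; rewrite !F0// subrr sub0r normrN pact_tperm opprB addrC subrK.
rewrite linearZ/= -scalemxAr !normrZ -/c => h.
apply/eqP; rewrite -subr_eq0 -normr_eq0.
have e1 := norm_edir_le1 R ij.
have := normr_ge0 (y ord0 i - y ord0 j); rewrite le_eqVlt => /predU1P[<-//|t0].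
move: h; rewrite mulrCA ler_pM2l// => h.
have : c / 2 * `|edir R i j| <= c / 2 by rewrite ger_pMr// divr_gt0.
lra.
Unshelve. all: by end_near. Qed.

(** The claim covers all [z] near [x], not just [x], because it is later applied to points
    approximating a limit point [x]. *)
Lemma tangent_dir_not_coord_eq (R : realType) (n m : nat) (M U : set 'rV[R]_n)
    (x : 'rV[R]_n) (F : 'I_m -> 'rV[R]_n -> R) (i j : 'I_n) :
  local_defining M x U F -> M x -> i != j ->
  grad_mx F x *m (edir R i j)^T = 0 ->
  \forall z \near x, M z -> ~ \forall y \near z, M y -> y ord0 i = y ord0 j.
Proof.
move=> Fdef Mx ij Je0; have [oU Ux _ _ MU] := Fdef.
have [K K0 nearK] := zero_set_near Fdef Mx.
have nearU : \forall y \near x, U y by exact: open_nbhs_nbhs.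
(* The error [(2 * K)^-1] makes the point of [M] found near [z + t e] lie within [t / 2] of it. *)
have [d d0 [dF dKU]] : exists2 d : R, 0 < d &
    (forall y z, `|y - x| < d -> `|z - x| < d ->
    `|values F y - values F z - grad_mx F x *m (y - z)^T|
      <= (2 * K)^-1 * `|y - z|) /\
    (forall p, `|p - x| < d ->
      (exists2 y, M y & `|y - p| <= K * `|values F p|) /\ U p).
  apply: near_right0_ex; apply: filterI.
    by apply: values_strict_diff Fdef _; rewrite invr_gt0 mulr_gt0.
  by apply/near_normP; exact: filterI.
have d2 : d / 2 < d by lra.
apply/near_normP; near=> r => z zr Mz zP.
have zd2 : `|z - x| < d / 2.
  by apply: lt_trans zr _; near: r; apply: nbhs_right_lt; rewrite divr_gt0.
have zd := lt_trans zd2 d2.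
have zij : z ord0 i = z ord0 j by apply: nbhs_singleton zP Mz.
have [rho rho0 rhoP] : exists2 rho : R, 0 < rho &
    forall y, `|y - z| < rho -> M y -> y ord0 i = y ord0 j.
  by apply: near_right0_ex; exact/near_normP.
(* This keeps [p] within [d] of [x], and [y], at distance at most [3t/2] from [z], within [rho]. *)
pose t := Num.min (rho / 2) (d / 2).
have t0 : 0 < t by rewrite lt_min !divr_gt0.
have trho : t <= rho / 2 by rewrite ge_min lexx.
have td : t <= d / 2 by rewrite ge_min lexx orbT.
pose p := z + t *: edir R i j.
have pz : p - z = t *: edir R i j by rewrite /p addrC addKr.
have e1 := norm_edir_le1 R ij.
have npz : `|p - z| <= t by rewrite pz normrZ gtr0_norm// ger_pMr.
have pd : `|p - x| < d.
  have -> : p - x = (p - z) + (z - x) by rewrite addrA subrK.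
  by apply: le_lt_trans (ler_normD _ _) _; lra.
have Fz : values F z = 0.
  apply/colP => k; rewrite !mxE.
  have : (M `&` U) z by split=> //; have [] := dKU _ zd.
  by rewrite MU => -[_ /(_ k)].
have [[y My yp] _] := dKU _ pd.
have Fp : `|values F p| <= (2 * K)^-1 * t.
  have := dF _ _ pd zd; rewrite Fz subr0 {1}pz.
  rewrite linearZ/= -scalemxAr Je0 scaler0 subr0 => h.
  by apply: le_trans h _; rewrite ler_pM2l// invr_gt0 mulr_gt0.
have {}yp : `|y - p| <= t / 2.
  apply: le_trans yp _; rewrite (_ : t / 2 = K * ((2 * K)^-1 * t)) ?ler_pM2l//.
  by field; rewrite gt_eqF.
have yij : y ord0 i = y ord0 j.
  apply: rhoP My.
  have -> : y - z = (y - p) + (p - z) by rewrite addrA subrK.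
  by apply: le_lt_trans (ler_normD _ _) _; lra.
(* The coordinates [i] and [j] of [p] differ by [2t], and moving each by at most [t / 2] cannot make
   them equal. *)
have := le_trans (normmx_ge_entry (y - p) ord0 i) yp.
have := le_trans (normmx_ge_entry (y - p) ord0 j) yp.
rewrite !mxE yij zij !eqxx/= eq_sym (negbTE ij)/= !ler_norml.
move=> /andP[_ yj] /andP[yi _].
by have := t0; rewrite ltNge => /negP; apply; lra.
Unshelve. all: by end_near. Qed.

(** * Connectedness argument and conclusion *)

Theorem theorem3p34 (R : realType) (n : nat) (M : set 'rV[R]_n)
    (sstar s : {perm 'I_n}) (xbar v : 'rV[R]_n) :
  C2_submanifold M -> locally_symmetric M ->
  characteristic_perm M sstar ->
  M xbar -> Delta s xbar ->
  mfd_normal M xbar v ->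
  forall i j : 'I_n, i \notin psupp sstar -> j \notin psupp sstar ->
    same_cycle s i j -> v ord0 i = v ord0 j.
Proof.
move=> [Mconn [d [dn charts]]] Msym [y0 [r [My0 r0 y0M]]] Mx Dx vN i j iF jF sij.
have [->//|ij] := eqVneq i j.
have xij : xbar ord0 i = xbar ord0 j by apply/Dx.
have [U [F Fdef]] := charts _ Mx.
have [Je0|Je0] := eqVneq (grad_mx F xbar *m (edir R i j)^T) 0.
  have : mfd_tangent M xbar (edir R i j) by exists (n - d)%N, U, F.
  move=> /vN; rewrite (bigD1 i)//= (bigD1 j) 1?eq_sym//= big1; last first.
    move=> k /andP[ki kj].
    by rewrite !mxE (negbTE ki) (negbTE kj) /= subrr mulr0.
  rewrite !mxE !eqxx (negbTE ij) [j == i]eq_sym (negbTE ij)/=.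
  by move=> h; apply/eqP; rewrite -subr_eq0; apply/eqP; rewrite -[RHS]h; ring.
(* As an implication, [E] has as interior the points near which [M] lies in the hyperplane. *)
pose E := [set x : 'rV[R]_n | M x -> x ord0 i = x ord0 j].
have clopen : M `&` interior E = M.
  apply: Mconn.
  - by exists xbar; split=> //; exact: locally_symmetric_coord_eq Fdef _ _ _ _.
  - by exists (interior E) => //; exact: open_interior.
  exists (closure (M `&` interior E)); first exact: closed_closure.
  apply/seteqP; split=> x [Mx' xE]; split=> //; first exact: subset_closure.
  (* The hyperplane is closed, so it contains the limit point [x] and the dichotomy applies there;
     tangency at [x] is excluded by nearby points of [interior E]. *)
  have x'ij : x ord0 i = x ord0 j.
    pose f (y : 'rV[R]_n) := y ord0 i - y ord0 j.
    have fcl : closed (f @^-1` [set 0]).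
      apply: closed_comp; last exact: closed_eq.
      move=> y _; have Ny : Filter (nbhs y) := nbhs_filter y.
      by apply: cvgB; exact: coord_continuous.
    apply/subr0_eq/fcl; apply: closureS xE => y [My yE].
    by rewrite /f /= (nbhs_singleton yE My) subrr.
  have [V [G Gdef]] := charts _ Mx'.
  have [JG0|JG0] := eqVneq (grad_mx G x *m (edir R i j)^T) 0; last first.
    exact: locally_symmetric_coord_eq Gdef _ _ _ _.
  have [z [[Mz zE] zN]] := xE _ (tangent_dir_not_coord_eq Gdef Mx' ij JG0).
  by case: (zN Mz zE).
have y0E : interior E y0 by have : M y0 by []; rewrite -{1}clopen => -[].
have y0r : ball_e y0 r y0 by exact: nbhs_singleton (ball_e_near y0 r0).
have y0ij : y0 ord0 i = y0 ord0 j := nbhs_singleton y0E My0.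
have : same_cycle sstar i j by apply/(y0M y0 (conj My0 y0r)).
(* The cycle of a fixed point of [sstar] is a singleton, against [i != j]. *)
rewrite /same_cycle; move: iF; rewrite inE negbK => /eqP si.
move=> /porbitP[k jk].
by move: ij; rewrite jk permX iter_fix// eqxx.
Qed.
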